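(* Let $n\geq 3$ and let $\pi_i f=\partial_i(P^{+}f)+Q_{+}\partial_i f+R_{+}f$, $1\leq i\leq n-1$, be a family of operators of one of the following two kinds, where $a,b,c,d$ are constants, not all $0$, with $ad-bc=0$. (1) For some constant $e$ that equals neither $0$ nor $b-c$, for all $i$ we have $P^{+}=a x_i x_{i+1}+(b-e)x_i+c x_{i+1}+d$, $Q_{+}=e x_i$, $R_{+}=0$. (2) For every $i$ independently, $(P^{+},Q_{+},R_{+})$ is one of the four triples - $\big(a x_i x_{i+1}+b x_i+c x_{i+1}+d,\ 0,\ 0\big)$; - $\big(a x_i x_{i+1}+c x_i+c x_{i+1}+d,\ (b-c)x_i,\ 0\big)$; - $\big(a x_i^2+(b+c)x_i+c x_{i+1}+d,\ -c x_i,\ -a x_i\big)$; - $\big(c x_{i+1}+d,\ a x_i^2+b x_i,\ -a x_i\big)$. Then the operators $\{\pi_i\}_{i=1}^{n-1}$ generate a Hecke algebra $\mathcal{H}_{b-c,\nu}$, where $\nu$ equals $e(e+c-b)$ in case (1) and $0$ in case (2).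
   Context: $K$ is a field of arbitrary characteristic over which all polynomials are defined; possible extra parameters are regarded as elements of $K$, so ''constant'' means an element of $K$. The operators act on functions $f$ of variables $x_1,\dots,x_n$ (concretely $f\in K[x_1,\dots,x_n]$). The operator $s_i$ interchanges $x_i$ and $x_{i+1}$, and $\partial_i f=\frac{f-s_i f}{x_i-x_{i+1}}$. Operators $\{\pi_i\}_{i=1}^{n-1}$ generate a Hecke algebra $\mathcal{H}_{\mu,\nu}$ if they satisfy the braid relations ($\pi_i\pi_k=\pi_k\pi_i$ for $|k-i|\geq 2$ and $\pi_i\pi_{i+1}\pi_i=\pi_{i+1}\pi_i\pi_{i+1}$ for $1\leq i\leq n-2$) and $\pi_i^2=\mu\pi_i+\nu\operatorname{Id}$ for every $1\leq i\leq n-1$. *)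

(* Defs.v *)
From mathcomp Require Export all_boot all_fingroup all_algebra.
From mathcomp Require Export mpoly.

Set Implicit Arguments.
Unset Strict Implicit.
Unset Printing Implicit Defensive.

Import GRing.Theory.
Local Open Scope ring_scope.

(* Indices are 0-based: the operator index [i : 'I_n.-1] refers to the adjacent
   pair of variables with indices [idxl i = i] and [idxr i = i + 1]. *)
Definition idxl (n : nat) (i : 'I_n.-1) : 'I_n := widen_ord (leq_pred n) i.

Fact idxr_subproof (n : nat) (i : 'I_n.-1) : (i.+1 < n)%N.
Proof. by case: n i => [|n] [i lt_i]. Qed.

Definition idxr (n : nat) (i : 'I_n.-1) : 'I_n := Ordinal (idxr_subproof i).

Definition xl (K : fieldType) (n : nat) (i : 'I_n.-1) : {mpoly K[n]} :=
  'X_(idxl i).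

Definition xr (K : fieldType) (n : nat) (i : 'I_n.-1) : {mpoly K[n]} :=
  'X_(idxr i).

Arguments xl K {n} i.
Arguments xr K {n} i.

Definition swapx (K : fieldType) (n : nat) (i : 'I_n.-1) (f : {mpoly K[n]}) :
    {mpoly K[n]} :=
  msym (tperm (idxl i) (idxr i)) f.

Lemma divdiff_exists (K : fieldType) (n : nat) (i : 'I_n.-1)
    (f : {mpoly K[n]}) :
  exists g : {mpoly K[n]}, g * (xl K i - xr K i) == f - swapx i f.
Proof.
set u := _ - _.
have hM (p q : {mpoly K[n]}) : (exists g, g * u == p - swapx i p) ->
    (exists g, g * u == q - swapx i q) ->
    exists g, g * u == p * q - swapx i (p * q).
  move=> [g /eqP hg] [h /eqP hh]; exists (g * q + swapx i p * h); apply/eqP.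
  rewrite mulrDl [g * q]mulrC -[q * g * u]mulrA hg.
  rewrite -[_ * h * u]mulrA hh /swapx msymM.
  by rewrite !mulrBr [q * p]mulrC [q * msym _ p]mulrC addrA subrK.
have hX (k : 'I_n) : exists g, g * u == 'X_k - swapx i 'X_k.
  have -> : swapx i 'X_k = 'X_(tperm (idxl i) (idxr i) k) :> {mpoly K[n]}.
    by rewrite /swapx /msym mmapX mmap1U.
  case: tpermP => [->|->|_ _]; [exists 1|exists (-1)|exists 0].
  - by rewrite mul1r.
  - by rewrite mulN1r opprB.
  - by rewrite mul0r subrr.
have h1 : exists g, g * u == 1 - swapx i 1.
  by exists 0; rewrite mul0r /swapx msym1 subrr.
elim/mpolyind: f => [|c m p _ _ [g /eqP hg]].
  by exists 0; rewrite mul0r /swapx msym0 subrr.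
have [h /eqP hh] : exists g, g * u == 'X_[m] - swapx i 'X_[m].
  rewrite mpolyXE_id.
  elim/big_ind: _ => // k _.
  by elim: (m k) => [|e IHe]; rewrite ?expr0 // exprS; apply: hM.
exists (c *: h + g); apply/eqP.
by rewrite mulrDl hg -scalerAl hh /swapx msymD msymZ scalerBr addrACA opprD.
Qed.

(* The exact quotient of [f - s_i f] by [x_i - x_{i+1}]; it is unique because
   [{mpoly K[n]}] is an integral domain. *)
Definition divdiff (K : fieldType) (n : nat) (i : 'I_n.-1)
    (f : {mpoly K[n]}) : {mpoly K[n]} :=
  xchoose (divdiff_exists i f).

Lemma divdiffE (K : fieldType) (n : nat) (i : 'I_n.-1) (f : {mpoly K[n]}) :
  divdiff i f * (xl K i - xr K i) = f - swapx i f.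
Proof. exact/eqP/(xchooseP (divdiff_exists i f)). Qed.

Lemma divdiff_unique (K : fieldType) (n : nat) (i : 'I_n.-1)
    (f g : {mpoly K[n]}) :
  g * (xl K i - xr K i) = f - swapx i f -> divdiff i f = g.
Proof.
rewrite -divdiffE => /esym; apply: mulIf.
rewrite subr_eq0 /xl /xr; apply/eqP => /mpolyP /(_ U_(idxl i)%MM).
rewrite !mcoeffX !eqxx.
have /negPf -> : U_(idxr i)%MM != U_(idxl i)%MM.
  apply/eqP => /mnmP /(_ (idxl i)); rewrite !mnm1E eqxx.
  by rewrite -val_eqE /= gtn_eqF.
by move/eqP; rewrite oner_eq0.
Qed.

Definition piop (K : fieldType) (n : nat) (P Q R : 'I_n.-1 -> {mpoly K[n]})
    (i : 'I_n.-1) (f : {mpoly K[n]}) : {mpoly K[n]} :=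
  divdiff i (P i * f) + Q i * divdiff i f + R i * f.

Definition generate_hecke (K : fieldType) (n : nat) (mu nu : K)
    (p : 'I_n.-1 -> {mpoly K[n]} -> {mpoly K[n]}) : Prop :=
  [/\ (forall i k : 'I_n.-1, ((i.+2 <= k) || (k.+2 <= i))%N ->
         p i \o p k =1 p k \o p i),
      (forall i k : 'I_n.-1, k = i.+1 :> nat ->
         p i \o p k \o p i =1 p k \o p i \o p k) &
      (forall (i : 'I_n.-1) (f : {mpoly K[n]}),
         p i (p i f) = mu *: p i f + nu *: f)].

(* Main.v *)
Require Import Defs.
From mathcomp Require Import ring zify.

Set Implicit Arguments.
Unset Strict Implicit.
Unset Printing Implicit Defensive.

Import GRing.Theory.
Local Open Scope ring_scope.

(* Every operator of the theorem has the form
   [pi f = (A(x, y) f - B(x, y) s f) / (x - y)] with [x, y] the two variables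
   exchanged by [s].  The numerator [A = a x y + b x + c y + d] is always the
   same, and only [B] depends on the triple.  The quadratic relation amounts to
   [A(x, y) A(y, x) - B(x, y) B(y, x) = nu (x - y)^2].  Expanding both sides of
   the braid relation over the six permutations of three variables, the
   coefficients agree because of this, of two quadratic identities for [A] that
   hold when [a d = b c], and of the mixed relation
   [B x y * C x z * B y z = C y z * B x z * C x y]
   between the functions [B], [C] of neighbouring operators.  That last relation
   holds in case (2) since [A(x, y)] is, up to a constant, a product
   [u(x) v(y)], and the four choices of [B] are
   [v(x) u(y)], [u(x) v(y)], [u(y) v(y)], [u(x) v(x)]. *)

(** * Identities for the bilinear numerator *)

Section BilinearNumerator.
Variables (R : comNzRingType) (a b c d : R).
Implicit Types x y z : R.

Definition bilin x y : R := a * (x * y) + b * x + c * y + d.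

(** The diagonal value [bilin x x]; when the numerator factors as u(x) v(y), this is u(x) v(x). *)
Definition quad x : R := a * x ^+ 2 + (b + c) * x + d.

Lemma bilin_sub_sym x y : bilin x y - bilin y x = (b - c) * (x - y).
Proof. by rewrite /bilin; ring. Qed.

Hypothesis det0 : a * d = b * c.

(** This identity and its mirror image below cancel the coefficients of [t f] and [s f] in the
    difference of the two braid products. *)
Lemma bilin_triangle_left x y z :
  bilin x y * bilin x z * (y - z) =
  bilin y z * bilin x y * (x - z) - bilin x z * bilin z y * (x - y).
Proof. by rewrite /bilin; ring: det0. Qed.

Lemma bilin_triangle_right x y z :
  bilin y z * bilin x z * (x - y) =
  bilin x y * bilin y z * (x - z) - bilin x z * bilin y x * (y - z).
Proof. by rewrite /bilin; ring: det0. Qed.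

Lemma bilin_triangle_cubic x y z :
  (y - z) * (bilin x y ^+ 2 * bilin y z * (x - z)
             - bilin x y * bilin y x * bilin x z * (y - z)) =
  (x - y) * (bilin y z ^+ 2 * bilin x y * (x - z)
             - bilin y z * bilin z y * bilin x z * (x - y)).
Proof.
(* Both sides reduce to the product of [x - y], [y - z] and the three values of [bilin]. *)
transitivity ((y - z) * bilin x y * (bilin y z * bilin x z * (x - y))).
  by rewrite bilin_triangle_right; ring.
transitivity ((x - y) * bilin y z * (bilin x y * bilin x z * (y - z))).
  by ring.
by rewrite bilin_triangle_left; ring.
Qed.

Lemma quad_mul x y : quad x * quad y = bilin x y * bilin y x.
Proof. by rewrite /bilin /quad; ring: det0. Qed.

(** The constructors follow the order of the four triples of case (2). *)
Inductive twist : (R -> R -> R) -> Prop :=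
| TwistSwap : twist (fun x y => bilin y x)
| TwistId : twist bilin
| TwistRight : twist (fun x y => quad y)
| TwistLeft : twist (fun x y => quad x).

Lemma twist_mulC B x y : twist B -> B x y * B y x = bilin x y * bilin y x.
Proof. by case; rewrite // ?quad_mul // mulrC // quad_mul mulrC. Qed.

Lemma twist_braid B C x y z : twist B -> twist C ->
  B x y * C x z * B y z = C y z * B x z * C x y.
Proof. by do 2!case; rewrite /bilin /quad; ring: det0. Qed.

End BilinearNumerator.

(** * Operators given by fractions over an integral domain *)

Section FractionalOperators.
Variable R : idomainType.
Implicit Types (A B C : R -> R -> R) (s t p q : R -> R) (x y z : R).

Definition equivariant s B := forall u v, s (B u v) = B (s u) (s v).

Definition fractional A B x y s p :=
  forall f, p f * (x - y) = A x y * f - B x y * s f.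

(** The sign of the reversed denominator is absorbed into the numerators, so one expansion formula
    serves both braid products. *)
Lemma fractional_swap A B x y s p : fractional A B x y s p ->
  fractional (fun u v => - A v u) (fun u v => - B v u) y x s p.
Proof. by move=> hp f; rewrite -opprB mulrN hp; ring. Qed.

Lemma fractional_morph A B x y s p (t : {rmorphism R -> R}) f :
    equivariant t A -> equivariant t B -> fractional A B x y s p ->
  t (p f) * (t x - t y) = A (t x) (t y) * t f - B (t x) (t y) * t (s f).
Proof.
by move=> tA tB hp; rewrite -!(rmorphB, rmorphM) hp rmorphB !rmorphM tA tB.
Qed.

(** Over the denominator [(x - y) ^+ 2], the square of [p] has coefficient
    [- B x y * (A x y - A y x)] at [s f] and [A x y ^+ 2 - B x y * B y x] at [f]. The relation for
    [mu] settles the first, and both relations together settle the second. *)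
Lemma fractional_quadratic A B x y (s : {rmorphism R -> R}) p (mu nu : R) :
    x != y -> s x = y -> s y = x -> involutive s ->
    equivariant s A -> equivariant s B -> fractional A B x y s p ->
    A x y - A y x = mu * (x - y) ->
    A x y * A y x - B x y * B y x = nu * (x - y) ^+ 2 ->
  forall f, p (p f) = mu * p f + nu * f.
Proof.
move=> neq_xy sx sy sK sA sB hp hmu hnu f.
have nz : (x - y) ^+ 2 != 0 by rewrite expf_neq0 // subr_eq0.
apply: (mulIf nz).
have := fractional_morph f sA sB hp; rewrite sx sy sK => hspf.
transitivity (p (p f) * (x - y) * (x - y)); first by ring.
rewrite hp.
transitivity (A x y * (p f * (x - y)) + B x y * (s (p f) * (y - x))).
  by ring.
rewrite hspf hp.
transitivity (A x y * A x y * f - B x y * B y x * f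
              - B x y * (A x y - A y x) * s f); first by ring.
rewrite hmu.
transitivity (mu * (p f * (x - y)) * (x - y) + nu * (x - y) ^+ 2 * f);
  last by ring.
rewrite hp -hnu.
transitivity (mu * (x - y) * A x y * f + A x y * A y x * f
              - B x y * B y x * f - B x y * (mu * (x - y)) * s f);
  last by ring.
by rewrite -hmu; ring.
Qed.

(** Each swap fixes the variables of the other operator, so both products have the same four-term
    numerator. *)
Lemma fractional_commute A B C x y z w (s t : {rmorphism R -> R}) p q :
    x != y -> z != w ->
    s z = z -> s w = w -> t x = x -> t y = y -> (forall f, s (t f) = t (s f)) ->
    equivariant s A -> equivariant s C -> equivariant t A -> equivariant t B ->
    fractional A B x y s p -> fractional A C z w t q ->
  forall f, p (q f) = q (p f).
Proof.
move=> neq_xy neq_zw sz sw tx ty stC sA sC tA tB hp hq f.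
have nz : (x - y) * (z - w) != 0 by rewrite mulf_neq0 ?subr_eq0.
apply: (mulIf nz).
have := fractional_morph f sA sC hq; rewrite sz sw => hsq.
have := fractional_morph f tA tB hp; rewrite tx ty => htp.
rewrite mulrA hp.
transitivity (q (p f) * (z - w) * (x - y)); last by ring.
rewrite hq.
transitivity (A x y * (q f * (z - w)) - B x y * (s (q f) * (z - w))).
  by ring.
rewrite hsq hq.
transitivity (A z w * (p f * (x - y)) - C z w * (t (p f) * (x - y)));
  last by ring.
by rewrite htp hp stC; ring.
Qed.

Lemma fractional_triple A B C x y z (s t : {rmorphism R -> R}) p q f :
    s x = y -> s y = x -> s z = z -> t x = x -> t y = z -> t z = y ->
    involutive s ->
    equivariant s A -> equivariant s B -> equivariant s C ->
    equivariant t A -> equivariant t B ->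
    fractional A B x y s p -> fractional A C y z t q ->
  p (q (p f)) * ((x - y) ^+ 2 * (x - z) * (y - z)) =
    (A x y ^+ 2 * A y z * (x - z) - B x y * B y x * A x z * (y - z)) * f
    - B x y * (A x y * A y z * (x - z) - A x z * A y x * (y - z)) * s f
    - A x y * C y z * A x z * (x - y) * t f
    + A x y * C y z * B x z * (x - y) * t (s f)
    + B x y * C x z * A y z * (x - y) * s (t f)
    - B x y * C x z * B y z * (x - y) * s (t (s f)).
Proof.
move=> sx sy sz tx ty tz sK sA sB sC tA tB hp hq.
have := fractional_morph f sA sB hp; rewrite sx sy sK => hsp.
have := fractional_morph f tA tB hp; rewrite tx ty => htp.
have hsq := fractional_morph (p f) sA sC hq; rewrite sy sz in hsq.
(* Applying [t] and then [s] carries [x - y] to [x - z] and then to [y - z]. *)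
have hstp : s (t (p f)) * (y - z) = A y z * s (t f) - B y z * s (t (s f)).
  by rewrite -[y in LHS]sx -[z in LHS]sz -rmorphB -rmorphM htp rmorphB !rmorphM
             sA sB sx sz.
transitivity (p (q (p f)) * (x - y) * ((x - y) * (x - z) * (y - z))).
  by ring.
rewrite hp.
transitivity (A x y * (x - y) * (x - z) * (q (p f) * (y - z))
              - B x y * (x - y) * (y - z) * (s (q (p f)) * (x - z))).
  by ring.
rewrite hq hsq.
transitivity (A x y * (A y z * (x - z) * (p f * (x - y))
                       - C y z * (x - y) * (t (p f) * (x - z)))
              + B x y * (A x z * (y - z) * (s (p f) * (y - x))
                         + C x z * (x - y) * (s (t (p f)) * (y - z)))).
  by ring.
by rewrite hp htp hsp hstp; ring.
Qed.

Lemma fractional_braid (a b c d nu : R) B C x y z (s t : {rmorphism R -> R})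
    p q :
    let A := bilin a b c d in
    a * d = b * c -> x != y -> y != z -> x != z ->
    s x = y -> s y = x -> s z = z -> t x = x -> t y = z -> t z = y ->
    involutive s -> involutive t ->
    (forall f, s (t (s f)) = t (s (t f))) ->
    equivariant s A -> equivariant s B -> equivariant s C ->
    equivariant t A -> equivariant t B -> equivariant t C ->
    (forall u v, A u v * A v u - B u v * B v u = nu * (u - v) ^+ 2) ->
    (forall u v, A u v * A v u - C u v * C v u = nu * (u - v) ^+ 2) ->
    B x y * C x z * B y z = C y z * B x z * C x y ->
    fractional A B x y s p -> fractional A C y z t q ->
  forall f, p (q (p f)) = q (p (q f)).
Proof.
move=> A det0 neq_xy neq_yz neq_xz sx sy sz tx ty tz sK tK stC.
move=> sA sB sC tA tB tC hB hC hBC hp hq f.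
(* A common denominator, up to sign, of the two braid products. *)
have nz : (x - y) ^+ 2 * (x - z) * (y - z) ^+ 2 != 0.
  by rewrite !mulf_neq0 ?expf_neq0 // subr_eq0.
have opp_eqv (r : {rmorphism R -> R}) D :
    equivariant r D -> equivariant r (fun u v => - D v u).
  by move=> rD u v; rewrite rmorphN rD.
have left_eq : A x y * A x z * (y - z) =
    A y z * A x y * (x - z) - A x z * A z y * (x - y).
  exact: bilin_triangle_left.
have right_eq : A y z * A x z * (x - y) =
    A x y * A y z * (x - z) - A x z * A y x * (y - z).
  exact: bilin_triangle_right.
have cubic_eq : (y - z) * (A x y ^+ 2 * A y z * (x - z)
                           - A x y * A y x * A x z * (y - z)) =
                (x - y) * (A y z ^+ 2 * A x y * (x - z)
                           - A y z * A z y * A x z * (x - y)).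
  exact: bilin_triangle_cubic.
clearbody A.
have lhs := fractional_triple f sx sy sz tx ty tz sK sA sB sC tA tB hp hq.
(* The reflection [x <-> z] exchanges the roles of the two operators. *)
have rhs := fractional_triple f tz ty tx sz sy sx tK
  (opp_eqv _ _ tA) (opp_eqv _ _ tC) (opp_eqv _ _ tB)
  (opp_eqv _ _ sA) (opp_eqv _ _ sC)
  (fractional_swap hq) (fractional_swap hp).
apply: (mulIf nz).
transitivity (p (q (p f)) * ((x - y) ^+ 2 * (x - z) * (y - z)) * (y - z)).
  by ring.
transitivity (- (q (p (q f)) * ((z - y) ^+ 2 * (z - x) * (y - x))) * - (x - y));
  last by ring.
rewrite lhs rhs -stC.
have BE : B x y * B y x = A x y * A y x - nu * (x - y) ^+ 2.
  by rewrite -hB; ring.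
have CE : C y z * C z y = A y z * A z y - nu * (y - z) ^+ 2.
  by rewrite -hC; ring.
(* The coefficients of [f] agree: replacing the norms of [B] and [C] by those of [A] adds
   [nu * (x - y) ^+ 2 * (y - z) ^+ 2 * A x z] to both sides of [cubic_eq]. *)
have id_eq : (y - z) * (A x y ^+ 2 * A y z * (x - z)
                        - B x y * B y x * A x z * (y - z)) =
             (x - y) * (A y z ^+ 2 * A x y * (x - z)
                        - C y z * C z y * A x z * (x - y)).
  rewrite BE CE.
  transitivity ((y - z) * (A x y ^+ 2 * A y z * (x - z)
                           - A x y * A y x * A x z * (y - z))
                + nu * (x - y) ^+ 2 * (y - z) ^+ 2 * A x z); first by ring.
  by rewrite cubic_eq; ring.
have sub0 (u v : R) : u = v -> u - v = 0 by move=> ->; rewrite subrr.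
move/sub0: left_eq => t0; move/sub0: right_eq => s0.
move/sub0: id_eq => id0; move/sub0: hBC => sts0.
apply/eqP; rewrite -subr_eq0; apply/eqP.
set e0 := LHS in id0; set es := LHS in s0; set et := LHS in t0.
set ests := LHS in sts0.
(* The terms in [s (t f)] and [t (s f)] cancel outright; the four remaining coefficients are
   multiples of the differences shown to vanish. *)
transitivity (e0 * f + B x y * (y - z) * es * s f - C y z * (x - y) * et * t f
              - (x - y) * (y - z) * ests * s (t (s f))).
  by rewrite /e0 /es /et /ests; ring.
by rewrite id0 s0 t0 sts0; ring.
Qed.

End FractionalOperators.

(** Each side is one transposition conjugated by the other, and both conjugates exchange [x] and
    [z]. *)
Lemma tperm_braid (T : finType) (x y z : T) : x != y -> y != z -> x != z ->
  (tperm x y * tperm y z * tperm x y = tperm y z * tperm x y * tperm y z)%g.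
Proof.
move=> neq_xy neq_yz neq_xz.
have conjE (s : {perm T}) u v : (tperm u v * s * tperm u v = s ^ tperm u v)%g.
  by rewrite /conjg tpermV mulgA.
by rewrite !conjE !tpermJ tpermL tpermR !tpermD // eq_sym.
Qed.

(** * Variable swaps on the polynomial ring *)

Section PolynomialOperators.
Variables (K : fieldType) (n : nat).
Implicit Types (i k : 'I_n.-1) (P Q R : 'I_n.-1 -> {mpoly K[n]}).
Implicit Types B C : {mpoly K[n]} -> {mpoly K[n]} -> {mpoly K[n]}.

Notation adj i := (tperm (idxl i) (idxr i)).
Notation op A B i := (fractional A B (xl K i) (xr K i) (swapx i)).

Lemma msym_var (s : 'S_n) (j : 'I_n) : msym s 'X_j = 'X_(s j) :> {mpoly K[n]}.
Proof. by rewrite /msym mmapX mmap1U. Qed.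

Lemma msym_const (s : 'S_n) (u : K) : msym s u%:MP = u%:MP.
Proof. by rewrite /msym mmapC. Qed.

Lemma mpolyX_neq (j k : 'I_n) : j != k -> 'X_j != 'X_k :> {mpoly K[n]}.
Proof.
move=> neq_jk; apply/eqP => /mpolyP /(_ U_(j)%MM) /eqP.
rewrite !mcoeffX eqxx.
have /negPf -> : U_(k)%MM != U_(j)%MM.
  apply: contra neq_jk => /eqP /mnmP /(_ j).
  by rewrite !mnm1E eqxx; case: eqP => [->|].
by rewrite oner_eq0.
Qed.

Lemma swapxD i : {morph @swapx K n i : f g / f + g}.
Proof. exact: msymD. Qed.

Lemma swapxN i : {morph @swapx K n i : f / - f}.
Proof. exact: msymN. Qed.

Lemma swapxM i : {morph @swapx K n i : f g / f * g}.
Proof. exact: msymM. Qed.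

Lemma swapx_const i (u : K) : swapx i u%:MP = u%:MP.
Proof. exact: msym_const. Qed.

Lemma swapx_l i : swapx i (xl K i) = xr K i.
Proof. by rewrite /swapx msym_var tpermL. Qed.

Lemma swapx_r i : swapx i (xr K i) = xl K i.
Proof. by rewrite /swapx msym_var tpermR. Qed.

Lemma swapxK i : involutive (@swapx K n i).
Proof. by move=> f; rewrite /swapx -msymMm tperm2 msym1m. Qed.

Lemma idx_neq i : idxl i != idxr i.
Proof. by rewrite -val_eqE /= neq_ltn ltnSn. Qed.

Lemma swapx_fix i (j : 'I_n) : idxl i != j -> idxr i != j ->
  swapx i 'X_j = 'X_j :> {mpoly K[n]}.
Proof. by move=> jl jr; rewrite /swapx msym_var tpermD. Qed.

Lemma swapx_commute i k (f : {mpoly K[n]}) :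
    idxl i != idxl k -> idxl i != idxr k ->
    idxr i != idxl k -> idxr i != idxr k ->
  swapx i (swapx k f) = swapx k (swapx i f).
Proof.
move=> ll lr rl rr; rewrite /swapx -!msymMm; congr msym.
by rewrite [RHS]conjgC tpermJ !tpermD // eq_sym.
Qed.

Lemma swapx_braid i k (f : {mpoly K[n]}) : idxr i = idxl k -> idxl i != idxr k ->
  swapx i (swapx k (swapx i f)) = swapx k (swapx i (swapx k f)).
Proof.
move=> ik lr; have := idx_neq i; have := idx_neq k.
rewrite /swapx -!msymMm ?mulgA ik => neq_yz neq_xy.
by rewrite tperm_braid.
Qed.

Lemma piop_fractional A B P Q R i :
    P i + Q i + R i * (xl K i - xr K i) = A (xl K i) (xr K i) ->
    swapx i (P i) + Q i = B (xl K i) (xr K i) ->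
  op A B i (piop P Q R i).
Proof.
move=> hA hB f; rewrite /piop !mulrDl divdiffE -mulrA divdiffE -hA -hB.
by rewrite swapxM; ring.
Qed.

(** * Hecke relations for a class of admissible functions [B] *)

Section Hecke.
Variables (a b c d nu : K).
Hypothesis det0 : a * d = b * c.
Let A := bilin (a%:MP : {mpoly K[n]}) b%:MP c%:MP d%:MP.
(** A predicate rather than a single function, since in case (2) each index chooses its [B]
    independently. *)
Variable admissible :
  ({mpoly K[n]} -> {mpoly K[n]} -> {mpoly K[n]}) -> Prop.
Hypothesis admissible_equivariant : forall (s : 'S_n) B,
  admissible B -> equivariant (msym s) B.
Hypothesis admissible_norm : forall B u v, admissible B ->
  A u v * A v u - B u v * B v u = nu%:MP * (u - v) ^+ 2.
Hypothesis admissible_braid : forall B C u v w, admissible B -> admissible C ->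
  B u v * C u w * B v w = C v w * B u w * C u v.

Lemma bilin_equivariant (s : 'S_n) : equivariant (msym s) A.
Proof. by move=> u v; rewrite /A /bilin !msymD !msymM !msym_const. Qed.

Lemma hecke_of_fractional p :
  (forall i, exists2 B, admissible B & op A B i (p i)) ->
  generate_hecke (b - c) nu p.
Proof.
move=> hp.
have detP : a%:MP * d%:MP = b%:MP * c%:MP :> {mpoly K[n]}.
  by rewrite -!mpolyCM det0.
have neq_x i : xl K i != xr K i by exact: mpolyX_neq (idx_neq i).
have far i k : (i.+2 <= k)%N -> p i \o p k =1 p k \o p i.
  move=> lt_ik f /=.
  have [[B admB hB] [C admC hC]] := (hp i, hp k).
  have ll : idxl i != idxl k by rewrite -val_eqE /=; lia.
  have lr : idxl i != idxr k by rewrite -val_eqE /=; lia.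
  have rl : idxr i != idxl k by rewrite -val_eqE /=; lia.
  have rr : idxr i != idxr k by rewrite -val_eqE /=; lia.
  have xk_fix : swapx i (xl K k) = xl K k by exact: swapx_fix.
  have yk_fix : swapx i (xr K k) = xr K k by exact: swapx_fix.
  have xi_fix : swapx k (xl K i) = xl K i by apply: swapx_fix; rewrite eq_sym.
  have yi_fix : swapx k (xr K i) = xr K i by apply: swapx_fix; rewrite eq_sym.
  have sA := bilin_equivariant.
  have sB s := admissible_equivariant s admB.
  have sC s := admissible_equivariant s admC.
  have stC (g : {mpoly K[n]}) : swapx i (swapx k g) = swapx k (swapx i g).
    exact: swapx_commute.
  exact: (@fractional_commute _ A B C _ _ _ _ (msym (adj i)) (msym (adj k))
    _ _ (neq_x i) (neq_x k) xk_fix yk_fix xi_fix yi_fix stC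
    (sA _) (sC _) (sA _) (sB _) hB hC f).
split=> [i k /orP[/far // | /far ki f]|i k ik f|i f]; first exact/esym/ki.
- have [[B admB hB] [C admC hC]] := (hp i, hp k).
  have rl : idxr i = idxl k by apply/val_inj; rewrite /= ik.
  have lr : idxl i != idxr k by rewrite -val_eqE /= ik; lia.
  have xrl : xr K i = xl K k by rewrite /xr rl.
  have xz_neq : xl K i != xr K k by exact: mpolyX_neq.
  have z_fix : swapx i (xr K k) = xr K k.
    by apply: swapx_fix; rewrite // rl idx_neq.
  have x_fix : swapx k (xl K i) = xl K i.
    by apply: swapx_fix; rewrite eq_sym // -rl idx_neq.
  have yz_neq := neq_x k; have y_swap := swapx_l k.
  have z_swap := swapx_r k; rewrite -xrl in yz_neq y_swap z_swap hC.
  have stB (g : {mpoly K[n]}) : swapx i (swapx k (swapx i g)) = swapx k (swapx i (swapx k g)).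
    exact: swapx_braid.
  have sA := bilin_equivariant.
  have sB s := admissible_equivariant s admB.
  have sC s := admissible_equivariant s admC.
  exact: (@fractional_braid _ _ _ _ _ nu%:MP B C _ _ _
    (msym (adj i)) (msym (adj k)) _ _ detP (neq_x i) yz_neq xz_neq
    (swapx_l i) (swapx_r i) z_fix x_fix y_swap z_swap (swapxK i) (swapxK k) stB
    (sA _) (sB _) (sC _) (sA _) (sB _) (sC _)
    (fun u v => admissible_norm u v admB) (fun u v => admissible_norm u v admC)
    (admissible_braid _ _ _ admB admC) hB hC f).
- have [B admB hB] := hp i.
  rewrite -!mul_mpolyC mpolyCB.
  exact: (@fractional_quadratic _ A B _ _ (msym (adj i)) _ _ _ (neq_x i)
    (swapx_l i) (swapx_r i) (swapxK i) (bilin_equivariant _)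
    (admissible_equivariant _ admB) hB (bilin_sub_sym _ _ _ _ _ _)
    (admissible_norm _ _ admB) f).
Qed.

End Hecke.
End PolynomialOperators.

Theorem proposition30 (K : fieldType) (n : nat) (hn : (3 <= n)%N)
    (a b c d : K)
    (habcd : ~ [/\ a = 0, b = 0, c = 0 & d = 0])
    (hdet : a * d - b * c = 0)
    (P Q R : 'I_n.-1 -> {mpoly K[n]}) :
  (forall e : K, e <> 0 -> e <> b - c ->
     (forall i : 'I_n.-1,
        [/\ P i = a *: (xl K i * xr K i) + (b - e) *: xl K i
                    + c *: xr K i + d%:MP,
            Q i = e *: xl K i
          & R i = 0]) ->
     generate_hecke (b - c) (e * (e + c - b)) (piop P Q R))
  /\
  ((forall i : 'I_n.-1,
      [\/ [/\ P i = a *: (xl K i * xr K i) + b *: xl K i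
                      + c *: xr K i + d%:MP,
              Q i = 0
            & R i = 0],
          [/\ P i = a *: (xl K i * xr K i) + c *: xl K i
                      + c *: xr K i + d%:MP,
              Q i = (b - c) *: xl K i
            & R i = 0],
          [/\ P i = a *: (xl K i ^+ 2) + (b + c) *: xl K i
                      + c *: xr K i + d%:MP,
              Q i = - c *: xl K i
            & R i = - a *: xl K i]
        | [/\ P i = c *: xr K i + d%:MP,
              Q i = a *: (xl K i ^+ 2) + b *: xl K i
            & R i = - a *: xl K i]]) ->
   generate_hecke (b - c) 0 (piop P Q R)).
Proof.
have det0 : a * d = b * c by apply/eqP; rewrite -subr_eq0 hdet.
have detP : a%:MP * d%:MP = b%:MP * c%:MP :> {mpoly K[n]}.
  by rewrite -!mpolyCM det0.
have swapE := (swapxD, swapxN, swapxM, swapx_const, swapx_l, swapx_r).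
split=> [e _ _ hPQR|hPQR].
  (* This is [swapx i (P i) + Q i] with [u], [v] for the two variables. *)
  pose B (u v : {mpoly K[n]}) :=
    bilin a%:MP b%:MP c%:MP d%:MP v u + e%:MP * (u - v).
  apply: (hecke_of_fractional det0 (admissible := fun C => C = B)).
  - move=> s _ -> u v.
    by rewrite /B msymD msymM msymB msym_const bilin_equivariant.
  (* With D = u - v, the product (A(v,u) + eD)(A(u,v) - eD) differs from A(u,v) A(v,u) by e(b -
     c)D^2 - e^2 D^2, whence the value of [nu]. *)
  - move=> _ u v ->; rewrite /B mpolyCM mpolyCB mpolyCD /bilin; ring.
  (* With one common [B], the mixed relation is mere commutativity. *)
  - by move=> _ _ u v w -> ->; ring.
  move=> i; exists B => //.
  have [hP hQ hR] := hPQR i.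
  apply: piop_fractional; rewrite hP hQ ?hR -!mul_mpolyC mpolyCB.
    by rewrite /bilin; ring.
  by rewrite /B /bilin !swapE; ring.
apply: (hecke_of_fractional det0
  (admissible := twist (a%:MP : {mpoly K[n]}) b%:MP c%:MP d%:MP)).
- by move=> s _ [] u v; rewrite ?bilin_equivariant // /quad
       !msymD !msymM !msym_const // msymD !msym_const.
- by move=> B u v /(twist_mulC detP) ->; rewrite subrr mpolyC0 mul0r.
- by move=> B C u v w; apply: twist_braid.
move=> i.
case: (hPQR i) => -[hP hQ hR].
- eexists; first exact: TwistSwap.
  apply: piop_fractional; rewrite hP hQ ?hR -!mul_mpolyC.
    by rewrite /bilin; ring.
  by rewrite /bilin !swapE; ring.
- eexists; first exact: TwistId.
  apply: piop_fractional; rewrite hP hQ ?hR -!mul_mpolyC mpolyCB.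
    by rewrite /bilin; ring.
  by rewrite /bilin !swapE; ring.
- eexists; first exact: TwistRight.
  apply: piop_fractional; rewrite hP hQ ?hR -!mul_mpolyC !mpolyCN mpolyCD expr2.
    by rewrite /bilin; ring.
  by rewrite /quad !swapE; ring.
- eexists; first exact: TwistLeft.
  apply: piop_fractional; rewrite hP hQ ?hR -!mul_mpolyC ?mpolyCN.
    by rewrite /bilin; ring.
  by rewrite /quad !swapE; ring.
Qed.
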